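(* For integers $3\leq x\leq y$, $\gamma_{P,c}(K_{1,x}\,\square\,K_{1,y})=x$.
   Context: Power domination: for $S\subseteq V(G)$, start with $M(S)=N[S]$ and repeatedly add a vertex $w$ whenever some $v\in M(S)$ has $w$ as its unique neighbour outside $M(S)$; $S$ is a connected power dominating set if the final $M(S)$ is $V(G)$ and $\langle S\rangle$ is connected; $\gamma_{P,c}(G)$ is the minimum size of such a set. The Cartesian product $G\,\square\,H$ has vertex set $V(G)\times V(H)$, with $(a,b)\sim(x,y)$ iff either $a=x$ and $by\in E(H)$, or $b=y$ and $ax\in E(G)$. $K_{1,x}$ is the star with $x$ leaves. *)

(* Defs.v *)
From mathcomp Require Import all_boot.

Set Implicit Arguments.
Unset Strict Implicit.
Unset Printing Implicit Defensive.

Record sgraph := SGraph {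
  svertex :> finType;
  sedge : rel svertex;
  sedge_sym : symmetric sedge;
  sedge_irrefl : irreflexive sedge
}.

Notation "u -- v" := (sedge u v) (at level 30, no associativity).

Section Induced.
Variables (G : sgraph) (S : {set G}).

Definition induced_edge : rel {v : G | v \in S} :=
  [rel u v | val u -- val v].

Lemma induced_edge_sym : symmetric induced_edge.
Proof. by move=> u v; exact: sedge_sym. Qed.

Lemma induced_edge_irrefl : irreflexive induced_edge.
Proof. by move=> u; exact: sedge_irrefl. Qed.

Definition induced := SGraph induced_edge_sym induced_edge_irrefl.

End Induced.

Definition connected_graph (G : sgraph) : bool :=
  (0 < #|G|) && [forall u : G, forall v : G, connect (@sedge G) u v].

Section PowerDomination.
Variable G : sgraph.

Definition open_nbhd (v : G) : {set G} := [set w | v -- w].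

Definition closed_nbhd (S : {set G}) : {set G} :=
  S :|: \bigcup_(v in S) open_nbhd v.

Definition forced (M : {set G}) (w : G) : bool :=
  [exists v in M, open_nbhd v :\: M == [set w]].

(* One round adds all currently forced vertices at once. Adding a vertex never
   invalidates another pending addition (if v forces w and M grows without
   containing w, then v still forces w), so the final set does not depend on
   the order of additions. *)
Definition monitor_step (M : {set G}) : {set G} :=
  M :|: [set w | forced M w].

(* Every round before stabilization adds a vertex, so #|G| rounds suffice. *)
Definition monitored (S : {set G}) : {set G} :=
  iter #|G| monitor_step (closed_nbhd S).

Definition connected_power_dominating (S : {set G}) : bool :=
  (monitored S == setT) && connected_graph (induced S).

(* The default [set: G] is itself connected power dominating when G is
   connected; the value is meaningful only for such G. *)
Definition gammaPc : nat :=
  #|[arg min_(S < [set: G] | connected_power_dominating S) #|S|]|.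

End PowerDomination.

Section CartesianProduct.
Variables G H : sgraph.

Definition cart_edge : rel (G * H) :=
  [rel p q | (p.1 == q.1) && (p.2 -- q.2) || (p.2 == q.2) && (p.1 -- q.1)].

Lemma cart_edge_sym : symmetric cart_edge.
Proof.
move=> p q; rewrite /cart_edge /= (eq_sym q.1) (eq_sym q.2).
by rewrite (sedge_sym q.1) (sedge_sym q.2).
Qed.

Lemma cart_edge_irrefl : irreflexive cart_edge.
Proof. by move=> p; rewrite /cart_edge /= !sedge_irrefl !andbF. Qed.

Definition cart_prod := SGraph cart_edge_sym cart_edge_irrefl.

End CartesianProduct.

Section Star.
Variable x : nat.

(* The centre is None; the leaves are Some i for i < x. *)
Definition star_edge : rel (option 'I_x) :=
  [rel u v | (u == None) != (v == None)].

Lemma star_edge_sym : symmetric star_edge.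
Proof. by move=> u v; rewrite /star_edge /= eq_sym. Qed.

Lemma star_edge_irrefl : irreflexive star_edge.
Proof. by move=> u; rewrite /star_edge /= eqxx. Qed.

Definition star := SGraph star_edge_sym star_edge_irrefl.

End Star.

(* Main.v *)
Require Import Defs.
From mathcomp Require Import all_boot.

(** Upper bound: the centre together with all but one of the vertices
    [(Some i, None)] dominates everything except the leaves of one row, each of
    which is then forced by its column head [(None, Some j)].
    Lower bound: let [S] be connected with fewer than [x] vertices.  Projected
    to either factor, [S] either meets the centre or is a single point, so it
    misses at least two leaves [A] of the first star and at least two leaves [B]
    of the second.  No vertex of [A * B] is dominated by [S], and every vertex
    outside [A * B] has none or at least two neighbours in it, so no vertex of
    [A * B] is ever forced. *)

Section Monitoring.
Set Implicit Arguments.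
Unset Strict Implicit.

Variable G : sgraph.
Implicit Types (S M F : {set G}) (u v w r : G).

Lemma mem_closed_nbhd S w :
  (w \in closed_nbhd S) = (w \in S) || [exists v in S, v -- w].
Proof.
rewrite inE; congr (_ || _); apply/bigcupP/exists_inP.
  by case=> v vS; rewrite inE => vw; exists v.
by case=> v vS vw; exists v; rewrite ?inE.
Qed.

Lemma monitor_stepT : monitor_step [set: G] = [set: G].
Proof. by rewrite /monitor_step setTU. Qed.

Lemma monitoredT S :
  monitor_step (closed_nbhd S) = [set: G] -> monitored S = [set: G].
Proof.
move=> stepT; rewrite /monitored; case E: #|G| => [|k].
  (* With no round to run, [G] has no vertices, so all sets over it coincide. *)
  by apply/setP=> v; have := max_card (pred1 v); rewrite card1 E.
by rewrite iterSr stepT; elim: k {E} => //= k ->; rewrite monitor_stepT.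
Qed.

(** [F] is a fort: a monitored vertex with a neighbour [w] in [F] has a second one there, also
    unmonitored, so it cannot force [w]. Disjointness from [F] thus survives each round. *)
Lemma fort_monitored S F :
    [disjoint closed_nbhd S & F] ->
    (forall v w, v \notin F -> w \in F -> v -- w ->
       exists w', [/\ w' \in F, w' != w & v -- w']) ->
  [disjoint monitored S & F].
Proof.
move=> dSF fortF; rewrite /monitored; elim: #|G| => //= k.
set M := iter k _ _ => dMF; rewrite disjoint_subset; apply/subsetP=> w.
rewrite !inE => /orP[wM|/exists_inP[v vM /eqP vMw]].
  by rewrite (disjointFr dMF wM).
apply/negP=> wF; have : w \in open_nbhd v :\: M by rewrite vMw set11.
rewrite !inE => /andP[_ vw].
have [|w' [w'F w'w vw']] := fortF v w _ wF vw.
  by rewrite (disjointFr dMF vM).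
have : w' \in [set w] by rewrite -vMw !inE vw' (disjointFl dMF w'F).
by rewrite inE (negPf w'w).
Qed.

Lemma connected_induced_radius2 S r :
    r \in S ->
    (forall u, u \in S ->
       exists2 w, w \in S & ((w == u) || (u -- w)) && ((w == r) || (w -- r))) ->
  connected_graph (induced S).
Proof.
move=> rS radS; apply/andP; split; first by apply/card_gt0P; exists (Sub r rS).
have csym : connect_sym (@sedge (induced S)).
  exact/sym_connect_sym/induced_edge_sym.
have near (u w : induced S) :
    (val w == val u) || (val u -- val w) -> connect (@sedge (induced S)) u w.
  by case/orP=> [/eqP/val_inj-> | uw]; [apply: connect0 | apply: connect1].
have to_r (u : induced S) : connect (@sedge (induced S)) u (Sub r rS).
  have [w wS /andP[uw wr]] := radS _ (valP u).
  apply: connect_trans (near u (Sub w wS) uw) (near _ _ _).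
  by rewrite /= eq_sym.
apply/forallP=> u; apply/forallP=> v.
by rewrite (connect_trans (to_r u)) 1?csym.
Qed.

(** Here [f] may collapse edges, as the projections of a product do. If the image contains the
    centre, at most [#|S| - 1] leaves are hit. Otherwise, as leaves are pairwise non-adjacent, [f]
    is constant on the connected [S] and hits at most one of at least three leaves. *)
Lemma connected_missed_leaves S z (f : G -> star z) :
    (forall u v, u -- v -> (f u == f v) || (f u -- f v)) ->
    2 < z -> #|S| < z -> connected_graph (induced S) ->
  1 < #|[set i | Some i \notin f @: S]|.
Proof.
move=> fhom z3 Sz /andP[_ /forallP conS].
set A := [set i | _].
have imS : Some @: (~: A) = (f @: S) :\ None.
  apply/setP=> -[i|]; last by rewrite !inE /=; apply/imsetP=> -[].
  by rewrite (mem_imset _ _ Some_inj) !inE negbK.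
suff : 1 + #|~: A| < z.
  by rewrite -[X in _ < X](card_ord z) -(cardsC A) ltn_add2r.
rewrite -(card_imset _ Some_inj) imS.
have [fN | fN] := boolP (None \in f @: S).
  have := cardsD1 None (f @: S); rewrite fN => <-.
  exact: leq_ltn_trans (leq_imset_card _ _) Sz.
have im1 := subset_leq_card (subD1set (f @: S) None).
apply: leq_ltn_trans z3; rewrite ltnS; apply: leq_trans im1 _.
apply/card_le1_eqP=> _ _ /imsetP[u uS ->] /imsetP[v vS ->].
(* The fibre of [f] through [u] is closed under adjacency in [S], hence contains [v]. *)
pose a := [pred w : induced S | f (val w) == f u].
have cla : closed (@sedge (induced S)) a.
  move=> w w' ww'; rewrite !inE.
  have /orP[/eqP-> // | ] := fhom _ _ (ww' : val w -- val w').
  have nN t : t \in S -> f t == None = false.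
    by move=> tS; apply: contraNF fN => /eqP <-; apply: imset_f.
  by rewrite /= /star_edge /= !nN ?(valP w) ?(valP w').
have := closed_connect cla (forallP (conS (Sub u uS)) (Sub v vS)).
by rewrite !inE /= eqxx => /esym/eqP.
Qed.

End Monitoring.

Section StarProduct.
Set Implicit Arguments.
Unset Strict Implicit.

Variables x y : nat.
Local Notation G := (cart_prod (star x) (star y)).
Implicit Type S : {set G}.

Lemma connected_induced_setT : connected_graph (induced [set: G]).
Proof.
apply: (@connected_induced_radius2 G _ (None, None)); first by rewrite inE.
move=> [a b] _; exists (None, b); first by rewrite inE.
by case: a b => [i|] [j|]; rewrite /= /cart_edge /= /star_edge /= ?eqxx ?orbT.
Qed.

(** Makes the default value in [gammaPc] an admissible set. *)
Lemma connected_power_dominating_setT : connected_power_dominating [set: G].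
Proof.
rewrite /connected_power_dominating connected_induced_setT andbT.
by rewrite monitoredT // /closed_nbhd setTU monitor_stepT.
Qed.

(** [[set~ Some i0]] contains [None], so the centre belongs to the set, which makes it connected. *)
Definition star_heads (i0 : 'I_x) : {set G} := setX [set~ Some i0] [set None].

Lemma card_star_heads i0 : #|star_heads i0| = x.
Proof. by rewrite cardsX cards1 muln1 cardsC1 card_option card_ord. Qed.

Lemma star_heads_power_dominating i0 :
  connected_power_dominating (star_heads i0).
Proof.
apply/andP; split.
  have dom (a : star x) (b : star y) :
      ((a, b) : G) \in closed_nbhd (star_heads i0)
               = ~~ ((a == Some i0) && (b != None)).
    rewrite mem_closed_nbhd; apply/idP/idP.
      case/orP=> [|/exists_inP[[c d]]]; rewrite !inE /=.
        by case/andP=> /negPf->.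
      rewrite /cart_edge /=.
      case/andP=> /negPf ci /eqP->; case/orP=> /andP[/eqP <- _].
        by rewrite ci.
      by rewrite andbF.
    case: b => [j|]; rewrite ?andbT ?andbF => ai.
      apply/orP; right; apply/exists_inP; exists ((a, None) : G).
        by rewrite !inE ai.
      by rewrite /= /cart_edge /= /star_edge /= eqxx.
    have [-> | ai0] := eqVneq a (Some i0); last by rewrite !inE ai0.
    apply/orP; right; apply/exists_inP.
    by exists ((None, None) : G); rewrite ?inE.
  rewrite monitoredT //; apply/setP=> -[a b]; rewrite in_setT.
  rewrite /monitor_step 2!inE dom.
  case: andP => //= -[/eqP-> bN]; apply/exists_inP.
  (* The neighbours of [(None, b)] are the centre and the leaf pairs of column [b]; of these only
     [(Some i0, b)] is undominated. *)
  exists ((None, b) : G); first by rewrite dom.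
  apply/eqP/setP=> -[c d]; rewrite !(inE, dom) negbK.
  rewrite /= /cart_edge /= /star_edge /= xpair_eqE.
  case: c d b bN => [c|] [d|] [b|] //= _;
    by rewrite ?andbF ?andbT // (eq_sym (Some b)).
apply: (@connected_induced_radius2 G _ (None, None)); first by rewrite !inE.
move=> [a b] uS; exists (a, b) => //; move: uS; rewrite !inE /= eqxx /=.
case/andP=> _ /eqP->; case: a => [i|].
  by rewrite /cart_edge /= /star_edge /= ?orbT.
by rewrite eqxx.
Qed.

Lemma connected_power_dominating_card S :
  2 < x -> x <= y -> connected_power_dominating S -> x <= #|S|.
Proof.
move=> x3 xy /andP[/eqP monS conS]; rewrite leqNgt; apply/negP=> Sx.
set A := [set i | Some i \notin [set (p : G).1 | p in S]].
set B := [set j | Some j \notin [set (p : G).2 | p in S]].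
have cA : 1 < #|A|.
  apply: connected_missed_leaves => // u v /orP[] /andP[] //; first by move->.
  by move=> _ ->; rewrite orbT.
have cB : 1 < #|B|.
  apply: connected_missed_leaves => //; last 2 first.
  - exact: leq_trans x3 xy.
  - exact: leq_trans Sx xy.
  move=> u v /orP[] /andP[]; last by move->.
  by move=> _ ->; rewrite orbT.
pose F : {set G} := setX (Some @: A) (Some @: B).
have FP (p : G) : reflect
    (exists i j, [/\ i \in A, j \in B & p = (Some i, Some j)])
    (p \in F).
  apply: (iffP idP) => [|[i [j [iA jB ->]]]]; last first.
    by rewrite in_setX /= !imset_f.
  case: p => a b; rewrite inE => /andP[/imsetP[i iA /= ->] /imsetP[j jB /= ->]].
  by exists i, j.
suff : [disjoint monitored S & F].
  have [i iA] : exists i, i \in A by apply/card_gt0P; apply: ltnW.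
  have [j jB] : exists j, j \in B by apply/card_gt0P; apply: ltnW.
  rewrite monS => /disjointFr/(_ (in_setT (Some i, Some j))).
  by rewrite in_setX /= !imset_f.
apply: fort_monitored.
  rewrite disjoint_sym disjoint_subset; apply/subsetP=> p /FP[i [j [iA jB ->]]].
  (* A vertex dominating [(Some i, Some j)] shares a coordinate with it, but [S] projects to neither
     [Some i] nor [Some j]. *)
  have nA b : ((Some i, b) : G) \notin S.
    by apply/negP=> /(imset_f (fun p : G => p.1)) iS; rewrite inE iS in iA.
  have nB a : ((a, Some j) : G) \notin S.
    by apply/negP=> /(imset_f (fun p : G => p.2)) jS; rewrite inE jS in jB.
  rewrite inE mem_closed_nbhd negb_or nA /=; apply/exists_inP=> -[[c d] cdS].
  case/orP=> /andP[/= /eqP E _]; first by rewrite E (negPf (nA _)) in cdS.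
  by rewrite E (negPf (nB _)) in cdS.
(* The coordinate not shared with [(Some i, Some j)] is the centre of its star, adjacent to every
   leaf; so replacing that leaf by another missed one gives the second neighbour in [F]. *)
move=> [c d] _ _ /FP[i [j [iA jB ->]]] /orP[] /andP[/= /eqP-> E].
  have [j'] : exists j', j' \in B :\ j.
    by apply/card_gt0P; rewrite -ltnS; move: cB; rewrite (cardsD1 j) jB.
  rewrite in_setD1 => /andP[j'j j'B]; exists (Some i, Some j'); split.
  - by apply/FP; exists i, j'.
  - by rewrite xpair_eqE negb_and j'j orbT.
  (* [star_edge] only tests for the centre, so [E] is the same statement for [j] and [j'] by
     conversion. *)
  - by rewrite /= /cart_edge /= eqxx (E : star_edge d (Some j')).
have [i'] : exists i', i' \in A :\ i.
  by apply/card_gt0P; rewrite -ltnS; move: cA; rewrite (cardsD1 i) iA.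
rewrite in_setD1 => /andP[i'i i'A]; exists (Some i', Some j); split.
- by apply/FP; exists i', j.
- by rewrite xpair_eqE negb_and i'i.
- by rewrite /= /cart_edge /= eqxx (E : star_edge c (Some i')) orbT.
Qed.

End StarProduct.

Theorem theorem8 (x y : nat) (hx : 3 <= x) (hxy : x <= y) :
  gammaPc (cart_prod (star x) (star y)) = x.
Proof.
rewrite /gammaPc; case: arg_minnP => [|S cpdS minS].
  exact: connected_power_dominating_setT.
apply/eqP; rewrite eqn_leq connected_power_dominating_card // andbT.
(* Any leaf can be the omitted one; index 0 exists because [x] is positive. *)
pose i0 := Ordinal (leq_trans (isT : 0 < 3) hx).
by have := minS _ (star_heads_power_dominating y i0); rewrite card_star_heads.
Qed.
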